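(* Let $G$ be a finite group and let $T=\gamma_k(G)$ for some integer $k\ge 1$. Let $\epsilon>0$ and suppose that $\Pr(P,G)\ge\epsilon$ whenever $P$ is a Sylow subgroup of $T$. Then $G$ has a nilpotent normal subgroup $R$ of nilpotency class at most $k+1$ such that both the exponent of $G/R$ and the order of $\gamma_{k+1}(R)$ are $\epsilon$-bounded.
   Context: For subsets $X,Y$ of a finite group, $\Pr(X,Y)=\frac{|\{(x,y)\in X\times Y : xy=yx\}|}{|X||Y|}$. $\gamma_k(G)$ is the $k$th term of the lower central series of $G$, with $\gamma_1(G)=G$ and $\gamma_{i+1}(G)=[\gamma_i(G),G]$. The exponent of a finite group is the least positive integer $e$ with $x^e=1$ for all elements $x$. ''$\epsilon$-bounded'' means bounded above by a number depending only on $\epsilon$. *)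

(* Defs.v *)
From mathcomp Require Import all_boot all_order all_algebra all_fingroup all_solvable.
From mathcomp Require Import reals.

Set Implicit Arguments.
Unset Strict Implicit.
Unset Printing Implicit Defensive.

Import GRing.Theory Num.Theory.

Local Open Scope ring_scope.

Definition commuting_pr (F : realType) (gT : finGroupType) (X Y : {set gT}) : F :=
  #|[set u in setX X Y | (u.1 * u.2 == u.2 * u.1)%g]|%:R / (#|X| * #|Y|)%:R.

(* Main.v *)
(** Fix an integer [N >= 2 / eps] and let [K = gamma_k(G)]. By averaging, every
    Sylow subgroup [P] of [K] has at least [#|P| / N] elements with at most [N]
    conjugates in [G]. Such an element is centralised by [g ^ N!] for every [g],
    since [g] permutes its conjugacy class. Hence, if [E] is the subgroup
    generated by the [N!]-th powers and [D = C_K(E)], every prime-power part of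
    [#|K : D|] is at most [N], so that [#|K : D|] divides [N!]. Thus
    [u = g ^ (N! (N!)!)] lies in [E] and acts trivially on [K / D], and for [a]
    in [K] and [E] we get [[a, u ^ N!] = [a, u] ^ N! = [a ^ N!, u] = 1], as
    [[a, u]] and [a ^ N!] lie in [D]. The subgroup [R] generated by the powers
    of exponent [N! (N!)! N!] therefore centralises [gamma_k(R)], which gives
    even [gamma_{k+1}(R) = 1]. *)

Require Import Defs.
From mathcomp Require Import all_boot all_order all_algebra all_fingroup all_solvable.
From mathcomp Require Import reals.

Set Implicit Arguments.
Unset Strict Implicit.
Unset Printing Implicit Defensive.

Import Order.TTheory GRing.Theory Num.Theory.

Section Powers.

Import GroupScope.

Definition powg (gT : finGroupType) (G : {set gT}) (m : nat) : {set gT} :=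
  <<[set x ^+ m | x in G]>>.

Canonical powg_group (gT : finGroupType) (G : {set gT}) m :=
  Eval hnf in [group of powg G m].

Variable gT : finGroupType.
Implicit Types (G H : {group gT}) (m n : nat).

Lemma mem_powg G m x : x \in G -> x ^+ m \in powg G m.
Proof. by move=> Gx; apply/mem_gen/imset_f. Qed.

Lemma powg_normal G m : powg G m <| G.
Proof.
apply/andP; split.
  by rewrite gen_subG; apply/subsetP=> _ /imsetP[x Gx ->]; rewrite groupX.
apply: norms_gen; apply/subsetP=> g Gg; rewrite inE.
apply/subsetP=> _ /imsetP[_ /imsetP[x Gx ->] ->].
by rewrite conjXg; apply/imset_f; rewrite groupJ.
Qed.

Lemma powgM_sub G m n : powg G (m * n) \subset powg G m.
Proof.
rewrite gen_subG; apply/subsetP=> _ /imsetP[x Gx ->].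
by rewrite expgM groupX ?mem_powg.
Qed.

Lemma exponent_quotient_powg G m : exponent (G / powg G m) %| m.
Proof.
apply/exponentP=> _ /morphimP[x Nx Gx ->].
by rewrite -morphX //= coset_id ?mem_powg.
Qed.

Lemma expg_index_dvd H G m x :
  H <| G -> x \in G -> #|G : H| %| m -> x ^+ m \in H.
Proof.
move=> /andP[_ nHG] Gx; rewrite -card_quotient // => dvdm.
have Nx := subsetP nHG x Gx.
apply: coset_idr; first exact: groupX.
rewrite morphX //; apply: (exponentP (dvdn_trans (exponent_dvdn _) dvdm)).
exact: mem_quotient.
Qed.

Lemma commute_expg_fact G n x g :
  #|x ^: G| <= n -> g \in G -> commute x (g ^+ n`!).
Proof.
move=> lexn Gg; apply: commute_sym; apply/cent1P.
suff: g ^+ n`! \in 'C_<[g]>[x] by case/setIP.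
apply: (@expg_index_dvd _ <[g]>); rewrite ?cycle_id //.
  by rewrite -sub_abelian_normal ?cycle_abelian ?subsetIl.
rewrite dvdn_fact // indexg_gt0 index_cent1 /=.
by apply: leq_trans lexn; rewrite subset_leq_card // imsetS ?cycle_subG.
Qed.

End Powers.

Section CommutingPowers.

Import GroupScope.

Variable gT : finGroupType.
Implicit Types (G H K E P : {group gT}) (n N : nat).

Lemma commg_expg_fact H K G n a g :
    K <| G -> H <| G -> #|K : H| <= n -> a \in K -> g \in G ->
  [~ a, g ^+ n`!] \in H.
Proof.
move=> nKG /andP[_ nHG] leKn Ka Gg.
have sKG := normal_sub nKG; have Ga := subsetP sKG a Ka.
have [Na Ng] := (subsetP nHG a Ga, subsetP nHG g Gg).
have ca : commute (coset H a) (coset H g ^+ n`!).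
  (* The class of [coset H a] in [G / H] stays inside [K / H], so it has at most [n] elements. *)
  apply: (@commute_expg_fact _ (G / H)); last exact: mem_quotient.
  apply: leq_trans leKn; rewrite -card_quotient ?(subset_trans sKG) //.
  rewrite subset_leq_card // class_sub_norm ?mem_quotient //.
  by rewrite quotient_norms ?normal_norm.
apply: coset_idr; first by rewrite groupR ?groupX.
by rewrite morphR ?groupX // morphX //; apply/eqP/commgP.
Qed.

Lemma card_commuting_pairs P G :
  #|[set u in setX P G | u.1 * u.2 == u.2 * u.1]|
    = (\sum_(x in P) #|'C_G[x]|)%N.
Proof.
rewrite -sum1_card (eq_bigl (fun u => (u.1 \in P) && (u.2 \in 'C_G[u.1]))).
  rewrite -(pair_big_dep (mem P) (fun x y => y \in 'C_G[x]) (fun _ _ => 1%N)) /=.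
  by apply: eq_bigr => x _; rewrite sum1_card.
case=> x y; rewrite in_set in_setX in_setI /= -andbA; congr (_ && (_ && _)).
by apply/eqP/cent1P => [/esym|/esym].
Qed.

Lemma card_small_classes P G N :
    (2 * (#|P| * #|G|)
       <= N * #|[set u in setX P G | (u.1 * u.2 == u.2 * u.1)%g]|)%N ->
  (#|P| <= N * #|[set x in P | #|x ^: G| <= N]|)%N.
Proof.
set X := [set x in P | _]; rewrite card_commuting_pairs big_distrr /= => leN.
(* Outside [X] the class of [x] has more than [N] elements, so [N * #|'C_G[x]|] is at most [#|G|].
   In the sum over [P] these terms use up only half of [2 * (#|P| * #|G|)]. *)
have bound x : x \in P -> (N * #|'C_G[x]| <= N * #|G| * (x \in X) + #|G|)%N.
  move=> Px; rewrite in_set Px /=; case: (leqP #|x ^: G| N) => [_|ltN].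
    rewrite muln1 (leq_trans _ (leq_addr _ _)) // leq_mul2l.
    by rewrite subset_leq_card ?orbT ?subsetIl.
  rewrite muln0 add0n -(Lagrange (subsetIl G 'C[x])) index_cent1 mulnC.
  by rewrite leq_mul2l ltnW ?orbT.
have sumX : (\sum_(x in P) (x \in X) = #|X|)%N.
  rewrite -sum1_card [LHS]big_mkcond [RHS]big_mkcond /=.
  by apply: eq_bigr => x _; rewrite in_set; case: (x \in P) => //=; case: leq.
rewrite -(leq_pmul2r (cardG_gt0 G)) -(leq_add2r (#|P| * #|G|)).
rewrite addnn -mul2n (leq_trans leN) // (leq_trans (leq_sum _ bound)) //.
by rewrite big_split sum_nat_const leq_add2r -big_distrr /= sumX mulnAC.
Qed.

(** The [p]-part of [#|K : H|] is [#|P : P :&: H|] for a Sylow [p]-subgroup [P]; being at most [N],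
    it divides [N!]. *)
Lemma Sylow_index_dvd_fact H K N :
    H <| K ->
    (forall P, Sylow K P -> (#|P| <= N * #|P :&: H|)%N) ->
  #|K : H| %| N`!.
Proof.
move=> nHK leN; apply/dvdn_partP => // p _.
have [P sylP] := Sylow_exists p K.
have nHP : P \subset 'N(H) := subset_trans (pHall_sub sylP) (normal_norm nHK).
have := leN P; rewrite /Sylow (pHall_Hall sylP).
rewrite (pgroup_p (pHall_pgroup sylP)) => /(_ isT) leP.
rewrite -card_quotient ?normal_norm // -(card_Hall (quotient_pHall nHP sylP)).
rewrite card_quotient // -indexgI dvdn_fact // indexg_gt0 /=.
by rewrite -(leq_pmul2l (cardG_gt0 (P :&: H))) Lagrange ?subsetIl // mulnC.
Qed.

(** Both [a] and [g] lie in [E], so they commute with [[~ a, g]], and the exponent [n] can be moved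
    from [g] to [a]; then [a ^+ n] centralises [E]. *)
Lemma commg_expg_cent K E n a g :
    #|K : 'C_K(E)| %| n -> 'C_K(E) <| K -> a \in K :&: E -> g \in E ->
    [~ a, g] \in 'C(E) ->
  [~ a, g ^+ n] = 1.
Proof.
move=> dvdn nDK /setIP[Ka Ea] Eg cag.
have com y (Ey : y \in E) : commute y [~ a, g].
  exact/commute_sym/(centP cag).
rewrite (commgX n (com g Eg)) -(commXg n (com a Ea)); apply/eqP/commgP.
by have /setIP[_ /centP] := expg_index_dvd nDK Ka dvdn; apply.
Qed.

Lemma lcn_powg_eq1 G N k :
    0 < k ->
    (forall P, Sylow 'L_k(G) P ->
       (#|P| <= N * #|[set x in P | #|x ^: G| <= N]|)%N) ->
  'L_k.+1(powg G (N`! * N`!`! * N`!)) = 1.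
Proof.
move=> k_gt0 leN; set R := powg _ _.
pose K := 'L_k(G); pose E := powg G N`!; pose D := 'C_K(E).
have nEG : E <| G := powg_normal G _.
have nKG : K <| G by apply: lcn_normal.
have nDG : D <| G.
  rewrite /normal (subset_trans (subsetIl _ _) (normal_sub nKG)) /=.
  by rewrite /D normsI ?norms_cent ?normal_norm.
have nDK : D <| K := normalS (subsetIl _ _) (normal_sub nKG) nDG.
have dvdKD : #|K : D| %| N`!.
  apply: Sylow_index_dvd_fact => // P sylP; apply: leq_trans (leN P sylP) _.
  rewrite leq_mul2l subset_leq_card ?orbT //.
  case/andP: sylP => _ /andP[sPK _].
  apply/subsetP=> x; rewrite in_set => /andP[Px leNx].
  rewrite in_setI Px in_setI (subsetP sPK) //=.
  rewrite /E /powg cent_gen; apply/centP=> _ /imsetP[g Gg ->].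
  exact: commute_expg_fact leNx Gg.
have sRE : R \subset E by rewrite /R -mulnA powgM_sub.
have sLR : 'L_k(R) \subset K :&: E.
  rewrite subsetI (subset_trans (lcn_sub _ _) sRE) andbT.
  exact/lcnS/normal_sub/powg_normal.
rewrite -(prednK k_gt0) lcnSn prednK //.
apply/commG1P/subsetP=> a /(subsetP sLR) KEa.
have /setIP[Ka _] := KEa.
rewrite /R /powg cent_gen; apply/centP=> _ /imsetP[g Gg ->].
(* The first factor of the exponent takes [g] into [E], the second takes its commutator with [a]
   into [D], and the third kills that commutator. *)
rewrite !expgM; apply/commgP/eqP.
apply: (@commg_expg_cent K E) => //; first by rewrite groupX ?mem_powg.
have /setIP[] // : [~ a, g ^+ N`! ^+ N`!`!] \in D.
apply: (commg_expg_fact nKG nDG) => //; last exact: groupX.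
by rewrite dvdn_leq ?fact_gt0.
Qed.

End CommutingPowers.

Theorem theorem1p3 (F : realType) (eps : F) (eps_gt0 : (0 < eps)%R) :
  exists B : nat,
  forall (gT : finGroupType) (G : {group gT}) (k : nat),
    1 <= k ->
    (forall P : {group gT}, Sylow 'L_k(G) P ->
       (eps <= commuting_pr F P G)%R) ->
  exists R : {group gT},
    [/\ (R <| G)%g,
        nilpotent R,
        nil_class R <= k.+1,
        exponent (G / R)%g <= B
      & #|'L_k.+1(R)%g| <= B].
Proof.
(* This gives [2 < N * eps], which turns the bound on the commuting probability into the hypothesis
   of [card_small_classes]. *)
pose N := Num.bound (2 / eps)%R.
exists (N`! * N`!`! * N`!) => gT G k k_gt0 prP.
have B_gt0 : 0 < N`! * N`!`! * N`! by rewrite !muln_gt0 !fact_gt0.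
have LR1 : ('L_k.+1(powg G (N`! * N`!`! * N`!)) = 1)%g.
  apply: lcn_powg_eq1 => // P /prP.
  rewrite /commuting_pr ler_pdivlMr => [leP|]; last first.
    by rewrite ltr0n muln_gt0 !cardG_gt0.
  apply: card_small_classes; rewrite -(ler_nat F).
  rewrite natrM [leRHS]natrM.
  have ltN : (2 < N%:R * eps)%R.
    rewrite -ltr_pdivrMr // archi_boundP //.
    by rewrite divr_ge0 // ltW.
  apply: le_trans (ler_wpM2l (ler0n F N) leP).
  by rewrite mulrA ler_wpM2r ?ler0n ?ltW.
have nilR : nilpotent (powg G (N`! * N`!`! * N`!)).
  by apply/lcnP; exists k.
exists (powg_group G (N`! * N`!`! * N`!)); split=> //.
- exact: powg_normal.
- exact: leq_trans (introT (lcn_nil_classP _ nilR) LR1) (leqnSn k).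
- exact: dvdn_leq (exponent_quotient_powg _ _).
- by rewrite /= LR1 cards1.
Qed.
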